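(* Let $K\subset\mathbb R^3$ be a nondegenerate tetrahedron and let $k\in\{0,1\}$. The degrees of freedom $$\int_e\boldsymbol v\cdot\boldsymbol t_e\, q\,\mathrm ds\quad \forall\, q\in\mathbb P_k(e),\ \text{on each edge } e\in\mathcal E(K),$$ $$\int_F(\operatorname{curl}\boldsymbol v)\times\boldsymbol n\,\mathrm ds\quad\text{on each face } F\in\mathcal F(K),$$ are unisolvent for the shape function space $\boldsymbol W_k(K)$; that is, for any prescribed values of these degrees of freedom (for a fixed basis of $\mathbb P_k(e)$ on each edge $e$; the value on each face $F$ being an arbitrary vector of the two-dimensional plane orthogonal to $\boldsymbol n|_F$) there exists exactly one $\boldsymbol v\in\boldsymbol W_k(K)$ taking these values.
   Context: $\mathbb P_m(G)$ is the space of polynomials of total degree at most $m$ on $G$ and $\mathbb P_m(G;\mathbb R^3)$ its vector-valued version. $\boldsymbol x_K$ is the barycenter of $K$. The space of shape functions is $$\boldsymbol W_k(K):=\nabla\mathbb P_{k+1}(K)\oplus\big((\boldsymbol x-\boldsymbol x_K)\times\mathbb P_1(K;\mathbb R^3)\big),\qquad k=0,1,$$ where $(\boldsymbol x-\boldsymbol x_K)\times\mathbb P_1(K;\mathbb R^3)=\{(\boldsymbol x-\boldsymbol x_K)\times\boldsymbol q:\boldsymbol q\in\mathbb P_1(K;\mathbb R^3)\}$. $\mathcal E(K)$ and $\mathcal F(K)$ are the sets of edges and faces of $K$, $\boldsymbol t_e$ is a fixed unit tangent vector of the edge $e$, and $\boldsymbol n$ is the unit outward normal vector to $\partial K$. It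 holds $\dim\boldsymbol W_0(K)=14$ and $\dim\boldsymbol W_1(K)=20$. *)

(* Defs.v *)
From HB Require Import structures.
From mathcomp Require Import all_boot all_order all_algebra.
From mathcomp Require Import all_classical all_reals all_analysis.
From mathcomp Require mpoly.
(* Notations of [mpoly] clash with those of the analysis library. *)
Import -(notations) mpoly.

Set Implicit Arguments.
Unset Strict Implicit.
Unset Printing Implicit Defensive.

Import Order.TTheory GRing.Theory Num.Theory.
Local Open Scope ring_scope.
Local Open Scope classical_set_scope.

Notation vec R := 'rV[R]_3.
Notation poly3 R := (mpoly 3 R).
(* Vector fields with polynomial components.  Polynomials are formal; over an
   infinite field they are the same as polynomial functions on any set with
   nonempty interior, such as a nondegenerate tetrahedron. *)
Notation vpoly R := 'rV[poly3 R]_3.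

Section VectorAlgebra.
Variable A : comNzRingType.

Definition dot (u v : 'rV[A]_3) : A := \sum_i u 0 i * v 0 i.

(* Indices are added in 'I_3 = Z/3Z: component [i] is
   u_(i+1) v_(i+2) - u_(i+2) v_(i+1). *)
Definition cross (u v : 'rV[A]_3) : 'rV[A]_3 :=
  \row_(i < 3) (u 0 (i + 1) * v 0 (i + 2) - u 0 (i + 2) * v 0 (i + 1)).

End VectorAlgebra.

Section Polynomials.
Variable R : realType.

Definition peval (p : poly3 R) (x : vec R) : R := meval (fun i => x 0 i) p.

(* [msize p] is one more than the total degree, and [msize 0 = 0]. *)
Definition deg_le (m : nat) (p : poly3 R) : Prop := (mpoly.msize p <= m.+1)%N.

Definition vpeval (v : vpoly R) (x : vec R) : vec R :=
  map_mx (fun p => peval p x) v.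

Definition grad (p : poly3 R) : vpoly R := \row_(i < 3) mderiv i p.

Definition curl (v : vpoly R) : vpoly R :=
  \row_(i < 3) (mderiv (i + 1) (v 0 (i + 2))
                - mderiv (i + 2) (v 0 (i + 1))).

(* The vector field x |-> x - c. *)
Definition centered (c : vec R) : vpoly R :=
  \row_(i < 3) (mpolyX R (mnm1 i) - mpolyC 3 (c 0 i)).

(* [b] is a basis of P_m(G), the space of restrictions to [G] of polynomials
   of total degree at most [m]; each basis element is given by a polynomial on
   R^3 restricting to it. *)
Definition poly_basis_on (G : set (vec R)) (m d : nat) (b : 'I_d -> poly3 R)
    : Prop :=
  (forall i, deg_le m (b i)) /\
  forall p, deg_le m p ->
    exists! c : 'rV[R]_d,
      forall x, G x -> peval p x = \sum_(i < d) c 0 i * peval (b i) x.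

End Polynomials.

Section Integrals.
Variable R : realType.
Implicit Types (a b c : vec R) (f : vec R -> R).

(* Euclidean length (the library norm on matrices is the sup norm). *)
Definition enorm (u : vec R) : R := Num.sqrt (dot u u).

Definition segment a b : set (vec R) :=
  [set x | exists s : R, 0 <= s <= 1 /\ x = a + s *: (b - a)].

Definition segment_integral a b f : R :=
  enorm (b - a) *
  \int[@lebesgue_measure R]_(s in `[0, 1]) f (a + s *: (b - a)).

Definition unit_triangle : set (R * R) :=
  [set s | [/\ 0 <= s.1, 0 <= s.2 & s.1 + s.2 <= 1]].

(* Integral for the surface measure of the triangle [a b c]; the factor in
   front is the Jacobian of its affine parametrization. *)
Definition triangle_integral a b c f : R :=
  enorm (cross (b - a) (c - a)) *
  \int[(@lebesgue_measure R \x @lebesgue_measure R)%E]_(s in unit_triangle)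
    f (a + s.1 *: (b - a) + s.2 *: (c - a)).

End Integrals.

Definition edge := {e : 'I_4 * 'I_4 | (e.1 < e.2)%N}.

Section Tetrahedron.
Variable R : realType.
(* The vertices of the tetrahedron K. *)
Variable a : 'I_4 -> vec R.

Definition nondegenerate_tet : Prop :=
  row_free (\matrix_(i < 3) (a (lift ord0 i) - a ord0)).

Definition barycenter : vec R := 4^-1 *: \sum_i a i.

Definition src (e : edge) : vec R := a (val e).1.
Definition tgt (e : edge) : vec R := a (val e).2.

(* Either of the two orientations. *)
Definition unit_tangent (e : edge) (t : vec R) : Prop :=
  enorm t = 1 /\ exists c : R, t = c *: (tgt e - src e).

(* Faces are indexed by the opposite vertex. *)
Definition fvertex (F : 'I_4) (i : 'I_3) : vec R := a (lift F i).

Definition outward_unit_normal (F : 'I_4) (n : vec R) : Prop :=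
  [/\ enorm n = 1,
      forall i j, dot n (fvertex F i - fvertex F j) = 0 &
      forall i, dot n (a F - fvertex F i) < 0].

Definition edge_integral (e : edge) (f : vec R -> R) : R :=
  segment_integral (src e) (tgt e) f.

Definition face_integral (F : 'I_4) (f : vec R -> vec R) : vec R :=
  \row_(j < 3) triangle_integral (fvertex F 0) (fvertex F 1) (fvertex F 2)
                 (fun x => f x 0 j).

Definition shape_space (k : nat) (v : vpoly R) : Prop :=
  exists (p : poly3 R) (q : vpoly R),
    [/\ deg_le k.+1 p, forall i, deg_le 1 (q 0 i) &
        v = grad p + cross (centered barycenter) q].

Definition edge_dof (e : edge) (t : vec R) (q : poly3 R) (v : vpoly R) : R :=
  edge_integral e (fun x => dot (vpeval v x) t * peval q x).

Definition face_dof (F : 'I_4) (n : vec R) (v : vpoly R) : vec R :=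
  face_integral F (fun x => cross (vpeval (curl v) x) n).

End Tetrahedron.

(* Main.v *)
Require Import Defs.
From HB Require Import structures.
From mathcomp Require Import all_boot all_order all_algebra.
From mathcomp Require Import all_classical all_reals all_analysis measurable_realfun.
From mathcomp Require Import ring lra.
From mathcomp Require mpoly.
Import -(notations) mpoly.

Set Implicit Arguments.
Unset Strict Implicit.
Unset Printing Implicit Defensive.

Import Order.TTheory GRing.Theory Num.Theory.
Import numFieldNormedType.Exports.
Local Open Scope ring_scope.
Local Open Scope classical_set_scope.

(** The degrees of freedom are as many as the dimension of the space, so the heart
    of the matter is that a shape function on which all of them vanish is zero.
    Write the position relative to the barycenter as [y]. A shape function is
    [b + y *m H + cross y (q + y *m M)] with [H] symmetric and [M] of trace zero
    ([shape_spaceP]), and [H = 0] when [k = 0]. Two observations drive the proof.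

    The tangential component of such a field is affine along every edge,
    although the field is quadratic. Hence the edge integrals know its mean on
    each edge and, if [k = 1], also its slope ([edge_dof_shape] and
    [edge_moments]).

    The curl is affine, so its integral over a face is determined by its value at
    the centroid of the face ([face_dof_shape]). The face integrals give the
    tangential part of this value; its normal part is given by the mean
    tangential components on the edges of the face, by the theorem of Stokes
    ([circulation_face_boundary]).

    If all degrees of freedom vanish, then the curl is zero at four affinely
    independent points, so it is zero and the field is a gradient
    [b + y *m H]. Its tangential component vanishes on all edges, which forces
    [H = 0] and then [b = 0] ([system_kernel]).

    Existence follows by counting dimensions. To avoid choosing bases of the
    constrained spaces, the unknowns [b], [H], [q], [M] range over all vectors
    and matrices, and the constraints on [H] and [M] become equations. An
    auxiliary normal component on each face makes up for the fact that the face
    data are tangential. This is an injective linear map between spaces of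
    dimension 28, hence a bijection ([solves_unique]). *)

(** * Exact integrals over the unit interval and the unit triangle *)

Section Quadrature.
Variable R : realType.
Local Notation mu := (@lebesgue_measure R).

Lemma integral_deriv_poly (P : {poly R}) (u v : R) : u <= v ->
  (\int[mu]_(s in `[u, v]) ((deriv P).[s])%:E = (P.[v] - P.[u])%:E)%E.
Proof.
rewrite le_eqVlt => /orP[/eqP <-|uv]; first by rewrite set_itv1 integral_set1 subrr.
rewrite (@continuous_FTC2 _ _ (horner P)) //.
- by apply: continuous_subspaceT => x; exact: continuous_horner.
- split=> [x _||]; first exact: derivable_horner.
  + by apply: cvg_at_right_filter; exact: continuous_horner.
  + by apply: cvg_at_left_filter; exact: continuous_horner.
- by move=> x _; rewrite -derivE.
Qed.

Lemma integral_quad (p0 p1 p2 u v : R) : u <= v ->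
  (\int[mu]_(s in `[u, v]) (p0 + p1 * s + p2 * s ^+ 2)%:E =
   (p0 * (v - u) + p1 * (v ^+ 2 - u ^+ 2) / 2
    + p2 * (v ^+ 3 - u ^+ 3) / 3)%:E)%E.
Proof.
pose P : {poly R} := p0%:P * 'X + (p1 / 2)%:P * 'X^2 + (p2 / 3)%:P * 'X^3.
move=> uv; transitivity (\int[mu]_(s in `[u, v]) ((deriv P).[s])%:E)%E.
  apply: eq_integral => s _; congr EFin.
  rewrite /P !poly.derivE.
  by rewrite !(hornerD, hornerM, hornerMn, hornerC, hornerX, hornerXn) /=; field.
rewrite integral_deriv_poly // /P; congr EFin.
rewrite !(hornerD, hornerM, hornerC, hornerX, hornerXn); by field.
Qed.

Lemma measurable_unit_triangle : measurable (@unit_triangle R).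
Proof.
have -> : @unit_triangle R = (fst @^-1` `[0, +oo[) `&` (snd @^-1` `[0, +oo[)
    `&` ((fun s : R * R => s.1 + s.2) @^-1` `]-oo, 1]).
  apply/seteqP; split => [s [s1 s2 s3]|s [[]]] /=.
    by split; [split|]; rewrite /= in_itv /= ?andbT.
  by rewrite !in_itv /= !andbT.
apply: measurableI; first apply: measurableI.
- by rewrite -[X in measurable X]setTI; apply: measurable_fst.
- by rewrite -[X in measurable X]setTI; apply: measurable_snd.
- rewrite -[X in measurable X]setTI.
  by apply: measurable_funD; [exact: measurable_fst|exact: measurable_snd|..].
Qed.

Lemma integrable_affine_triangle (p0 p1 p2 : R) :
  (mu \x mu)%E.-integrable (@unit_triangle R)
    (EFin \o (fun s : R * R => p0 + p1 * s.1 + p2 * s.2)).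
Proof.
apply: measurable_bounded_integrable.
- exact: measurable_unit_triangle.
- apply: (@le_lt_trans _ _ ((mu \x mu)%E (`[0, 1] `*` `[0, 1]))).
    apply: le_measure; rewrite ?inE.
    + exact: measurable_unit_triangle.
    + by apply: measurableX.
    + by move=> s [s1 s2 s3]; split; rewrite /= in_itv /=; lra.
  rewrite product_measure1E //= !lebesgue_measure_itv /= lte01 oppr0 !adde0.
  by rewrite mule1 ltry.
- apply: measurable_funTS.
  apply: (@measurable_funD _ _ _ _ (fun s : R * R => p0 + p1 * s.1)).
    apply: (@measurable_funD _ _ _ _ (fun s : R * R => p0)) => //.
    by apply: measurable_funM => //; exact: measurable_fst.
  by apply: measurable_funM => //; exact: measurable_snd.
- exists (`|p0| + `|p1| + `|p2|); split; first exact: num_real.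
  move=> M ltM s [s1 s2 s3]; apply: le_trans (ltW ltM).
  apply: le_trans (ler_normD _ _) _; rewrite lerD //.
    apply: le_trans (ler_normD _ _) _; rewrite lerD // normrM ler_piMr //.
    by rewrite ger0_norm //; lra.
  by rewrite normrM ler_piMr // ger0_norm //; lra.
Qed.

(** The mean of an affine function on a triangle is its value at the centroid.
    By Fubini's theorem the integral is that of a quadratic polynomial, the
    integral over the slice at [x] being the one over [0, 1 - x]. *)
Lemma Rintegral_affine_triangle (p0 p1 p2 : R) :
  \int[(mu \x mu)%E]_(s in @unit_triangle R) (p0 + p1 * s.1 + p2 * s.2) =
  2^-1 * (p0 + p1 / 3 + p2 / 3).
Proof.
rewrite /Rintegral integral_mkcond -integral12_prod_meas1 /=; last first.
  apply/integrable_restrict => //; rewrite ?setTI.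
  - exact: measurable_unit_triangle.
  - exact: integrable_affine_triangle.
rewrite /fubini_F.
transitivity (fine (\int[mu]_(s in `[0%R, 1%R])
    ((p0 + p2 / 2) + (p1 - p0 - p2) * s + (p2 / 2 - p1) * s ^+ 2)%:E)%E).
  congr fine; rewrite [in RHS]integral_mkcond /=; apply: eq_integral => x _.
  rewrite patchE; case: ifPn => [|].
    rewrite inE /= in_itv /= => /andP[x0 x1].
    transitivity (\int[mu]_(y in `[0%R, (1 - (x : R))%R])
        ((p0 + p1 * x) + p2 * y + 0 * y ^+ 2)%:E)%E.
      rewrite [in RHS]integral_mkcond; apply: eq_integral => y _.
      rewrite !patchE; congr (if _ then _ else _); last first.
        by rewrite /= mul0r addr0.
      apply/idP/idP; rewrite !inE /= in_itv /=.
        by move=> [/= h1 h2 h3]; lra.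
      by move=> /andP[h1 h2]; split => //=; lra.
    rewrite integral_quad ?subr_ge0 //; congr EFin; by field.
  move=> xn; rewrite -[RHS](integral0 mu setT); apply: eq_integral => y _.
  rewrite patchE memNset // => -[/= h1 h2 h3].
  by move/negP: xn; apply; rewrite inE /= in_itv /=; lra.
rewrite integral_quad //=; by field.
Qed.

End Quadrature.

(** * Vector algebra in three dimensions *)

Section Vec3.
Variable A : comNzRingType.
Implicit Types u v w : 'rV[A]_3.

Lemma sum3E (V : nmodType) (F : 'I_3 -> V) : \sum_i F i = F 0 + F 1 + F 2.
Proof.
rewrite !big_ord_recl big_ord0 addr0 addrA.
by congr (_ + F _ + F _); apply: val_inj.
Qed.

Lemma row3P u v : u 0 0 = v 0 0 -> u 0 1 = v 0 1 -> u 0 2 = v 0 2 -> u = v.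
Proof.
move=> e0 e1 e2; apply/rowP => -[[|[|[|i]]] //= lti].
- by rewrite [Ordinal _](_ : _ = 0) //; apply: val_inj.
- by rewrite [Ordinal _](_ : _ = 1) //; apply: val_inj.
- by rewrite [Ordinal _](_ : _ = 2) //; apply: val_inj.
Qed.

Lemma addI3E :
  (((0 + 1)%R = 1%R :> 'I_3) * ((0 + 2)%R = 2%R :> 'I_3)
   * ((1 + 1)%R = 2%R :> 'I_3) * ((1 + 2)%R = 0%R :> 'I_3)
   * ((2 + 1)%R = 0%R :> 'I_3) * ((2 + 2)%R = 1%R :> 'I_3))%type.
Proof. by do !split; apply: val_inj. Qed.

Lemma dotE u v : dot u v = u 0 0 * v 0 0 + u 0 1 * v 0 1 + u 0 2 * v 0 2.
Proof. exact: sum3E. Qed.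

Definition vec3E := (dotE, sum3E, addI3E, mxE).

Lemma dotC u v : dot u v = dot v u.
Proof. by rewrite !vec3E; ring. Qed.

Lemma dotDl u v w : dot (u + v) w = dot u w + dot v w.
Proof. by rewrite !vec3E; ring. Qed.

Lemma dotZl x u w : dot (x *: u) w = x * dot u w.
Proof. by rewrite !vec3E; ring. Qed.

Lemma dotZr x u w : dot u (x *: w) = x * dot u w.
Proof. by rewrite !vec3E; ring. Qed.

Lemma dotNl u w : dot (- u) w = - dot u w.
Proof. by rewrite !vec3E; ring. Qed.

Lemma dotDr u v w : dot u (v + w) = dot u v + dot u w.
Proof. by rewrite !vec3E; ring. Qed.

Lemma dotNr u w : dot u (- w) = - dot u w.
Proof. by rewrite !vec3E; ring. Qed.

Lemma dot0l u : dot 0 u = 0.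
Proof. by rewrite !vec3E; ring. Qed.

Lemma crossDr u v w : cross u (v + w) = cross u v + cross u w.
Proof. by apply: row3P; rewrite !vec3E; ring. Qed.

Lemma crossDl u v w : cross (u + v) w = cross u w + cross v w.
Proof. by apply: row3P; rewrite !vec3E; ring. Qed.

Lemma crossZr x u v : cross u (x *: v) = x *: cross u v.
Proof. by apply: row3P; rewrite !vec3E; ring. Qed.

Lemma crossZl x u v : cross (x *: u) v = x *: cross u v.
Proof. by apply: row3P; rewrite !vec3E; ring. Qed.

Lemma cross0r u : cross u 0 = 0.
Proof. by apply: row3P; rewrite !vec3E; ring. Qed.

Lemma crossvv u : cross u u = 0.
Proof. by apply: row3P; rewrite !vec3E; ring. Qed.

Lemma dot_crossr u v : dot (cross u v) v = 0.
Proof. by rewrite !vec3E; ring. Qed.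

Lemma cross_cross u v : cross v (cross u v) = dot v v *: u - dot u v *: v.
Proof. by apply: row3P; rewrite !vec3E; ring. Qed.

Lemma cross_crossl u v w : cross (cross u v) w = dot u w *: v - dot v w *: u.
Proof. by apply: row3P; rewrite !vec3E; ring. Qed.

End Vec3.

(** * The shape functions in coordinates *)

Section Field.
Variable A : comNzRingType.
Implicit Types (b q y z : 'rV[A]_3) (H M : 'M[A]_3).

(** Every shape function has this form, with [y] the position relative to the
    barycenter: [b + y *m H], with [H] symmetric, is the gradient of a quadratic
    polynomial, and [q + y *m M] is a vector field of degree one. The definition
    is over an arbitrary ring because it is used both for numbers and for formal
    polynomials. *)
Definition shape_field b H q M y : 'rV[A]_3 := b + y *m H + cross y (q + y *m M).

(** The curl of [y |-> cross y (q + y *m M)]. Its linear part determines [M] once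
    the trace of [M] is fixed; the trace itself is invisible because
    [cross y y = 0]. *)
Definition curl_field q M y : 'rV[A]_3 := y *m ((\tr M)%:M - M *+ 3) - q *+ 2.

Lemma mxtrace3 M : \tr M = M 0 0 + M 1 1 + M 2 2.
Proof. exact: sum3E. Qed.

Lemma shape_fieldE b H q M y (r := q + y *m M) :
  ((shape_field b H q M y 0 0 = b 0 0 + (y 0 0 * H 0 0 + y 0 1 * H 1 0 + y 0 2 * H 2 0)
     + (y 0 1 * r 0 2 - y 0 2 * r 0 1))%R *
   (shape_field b H q M y 0 1 = b 0 1 + (y 0 0 * H 0 1 + y 0 1 * H 1 1 + y 0 2 * H 2 1)
     + (y 0 2 * r 0 0 - y 0 0 * r 0 2))%R *
   (shape_field b H q M y 0 2 = b 0 2 + (y 0 0 * H 0 2 + y 0 1 * H 1 2 + y 0 2 * H 2 2)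
     + (y 0 0 * r 0 1 - y 0 1 * r 0 0))%R)%type.
Proof.
rewrite /shape_field -/r; move: r => r.
by do !split; rewrite !(mxE, sum3E, addI3E).
Qed.

Lemma affineE q M y i : (q + y *m M) 0 i =
  q 0 i + (y 0 0 * M 0 i + y 0 1 * M 1 i + y 0 2 * M 2 i).
Proof. by rewrite !mxE sum3E. Qed.

Lemma crossE (u v : 'rV[A]_3) :
  ((cross u v 0 0 = u 0 1 * v 0 2 - u 0 2 * v 0 1)%R *
   (cross u v 0 1 = u 0 2 * v 0 0 - u 0 0 * v 0 2)%R *
   (cross u v 0 2 = u 0 0 * v 0 1 - u 0 1 * v 0 0)%R)%type.
Proof. by do !split; rewrite mxE !addI3E. Qed.

Lemma curl_fieldE q M y :
  ((curl_field q M y 0 0 = y 0 0 * (M 1 1 + M 2 2 - M 0 0 *+ 2)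
      - y 0 1 * M 1 0 *+ 3 - y 0 2 * M 2 0 *+ 3 - q 0 0 *+ 2)%R *
   (curl_field q M y 0 1 = y 0 1 * (M 0 0 + M 2 2 - M 1 1 *+ 2)
      - y 0 0 * M 0 1 *+ 3 - y 0 2 * M 2 1 *+ 3 - q 0 1 *+ 2)%R *
   (curl_field q M y 0 2 = y 0 2 * (M 0 0 + M 1 1 - M 2 2 *+ 2)
      - y 0 0 * M 0 2 *+ 3 - y 0 1 * M 1 2 *+ 3 - q 0 2 *+ 2)%R)%type.
Proof.
rewrite /curl_field mxtrace3; do !split;
  rewrite !(mxE, sum3E, mulmxnE) /=; ring.
Qed.

End Field.

(** * Circulations along segments and the theorem of Stokes *)

Section Circulation.
Variable R : realType.
Implicit Types (b q u v y z : 'rV[R]_3) (H M : 'M[R]_3).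

(** The integral of the tangential component over the segment from [y] to [z],
    written with the midpoint rule. The rule is exact: although the field is
    quadratic, its component along a line is affine on that line, because
    [dot (cross y (y *m M)) d] loses its quadratic term on lines of
    direction [d]. *)
Definition edge_circulation b H q M y z : R :=
  dot (shape_field b H q M (2^-1 *: (y + z))) (z - y).

Definition edge_slope b H q M u v : R :=
  dot (shape_field b H q M v - shape_field b H q M u) (v - u).

(** The second number attached to an edge. In degree one it is the slope of the
    tangential component. In degree zero the field has no quadratic potential,
    and the numbers [dot (d *m H) d] on the six edges are set to zero in order to
    force [H = 0]; both cases then lead to a system of the same size. When
    [q = 0] and [M = 0] the two formulas agree. *)
Definition edge_variation (k : nat) b H q M u v : R :=
  if k == 0%N then dot ((v - u) *m H) (v - u) else edge_slope b H q M u v.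

Lemma edge_circulationC b H q M u v :
  edge_circulation b H q M u v = - edge_circulation b H q M v u.
Proof. by rewrite /edge_circulation (addrC u) -(opprB u v) dotNr. Qed.

Lemma shape_field_along_edge b H q M u v s :
  dot (shape_field b H q M (u + s *: (v - u))) (v - u) =
  edge_circulation b H q M u v + (s - 2^-1) * edge_slope b H q M u v.
Proof.
have subE (w z : vec R) i : (w - z) 0 i = w 0 i - z 0 i by rewrite !mxE.
rewrite /edge_circulation /edge_slope !dotE !subE !shape_fieldE !affineE !mxE.
by field.
Qed.

(** The theorem of Stokes on a triangle. The curl is affine, so that its flux is
    its value at the centroid times the vector area, which is half of the cross
    product of two sides. The gradient part [b + y *m H] has no circulation
    because [H] is symmetric. *)
Lemma circulation_face_boundary b H q M y0 y1 y2 : H^T = H ->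
  edge_circulation b H q M y0 y1 + edge_circulation b H q M y1 y2
    + edge_circulation b H q M y2 y0 =
  2^-1 * dot (curl_field q M (3^-1 *: (y0 + y1 + y2)))
             (cross (y1 - y0) (y2 - y0)).
Proof.
move=> /matrixP sH.
have sH10 := sH 0 1; have sH20 := sH 0 2; have sH21 := sH 1 2.
rewrite !mxE in sH10 sH20 sH21.
rewrite /edge_circulation !dotE !shape_fieldE !affineE !curl_fieldE !crossE.
rewrite sH10 sH20 sH21 !mxE.
by field.
Qed.

End Circulation.

(** * Geometry of the tetrahedron *)

Lemma enorm_eq0 (R : realType) (u : vec R) : (enorm u == 0) = (u == 0).
Proof.
rewrite /enorm sqrtr_eq0; apply/idP/eqP => [u0|->]; last by rewrite dot0l.
have {}u0 : \sum_i u 0 i ^+ 2 == 0.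
  rewrite eq_le (eq_bigr (fun i => u 0 i * u 0 i)) => [|i _]; last exact: expr2.
  by rewrite u0; apply: sumr_ge0 => i _; rewrite -expr2 sqr_ge0.
move: u0; rewrite psumr_eq0 => [/allP u0|i _]; last exact: sqr_ge0.
apply/rowP => i; have := u0 i; rewrite mem_index_enum mxE sqrf_eq0.
by move=> /(_ isT)/eqP.
Qed.

Lemma dot_unit (R : realType) (u : vec R) : enorm u = 1 -> dot u u = 1.
Proof.
move=> u1; have : (0 < dot u u) || (dot u u <= 0) by case: ltP.
case/orP => [u0|u0]; first by rewrite -[LHS]sqr_sqrtr ?ltW // -/(enorm u) u1 expr1n.
by have /eqP := oner_neq0 R; rewrite -u1 /enorm ler0_sqrtr.
Qed.

Section Tetrahedron.
Variables (R : realType) (a : 'I_4 -> vec R).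
Hypothesis Knd : nondegenerate_tet a.

Let y i : vec R := a i - barycenter a.

Lemma sum_centered : \sum_i y i = 0.
Proof.
rewrite /y sumrB sumr_const card_ord /barycenter -scaler_nat scalerA.
by rewrite mulfV ?scale1r ?subrr // pnatr_eq0.
Qed.

(** The vectors from one vertex to the others form a basis, so a matrix that
    kills them is zero. *)
Lemma edge_vectors_span m (X : 'M[R]_(3, m)) :
  (forall i, (a i - a ord0) *m X = 0) -> X = 0.
Proof.
move=> aX0; rewrite -[LHS](@mulKmx _ _ _ (\matrix_(i < 3) (a (lift ord0 i) - a ord0))).
  rewrite (_ : _ *m X = 0) ?mulmx0 //.
  by apply/row_matrixP => i; rewrite row_mul rowK aX0 row0.
by rewrite -row_free_unit.
Qed.

Lemma dot_mul (u v : vec R) : dot u v = (u *m v^T) 0 0.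
Proof. by rewrite mxE; apply: eq_bigr => i _; rewrite mxE. Qed.

Lemma edge_vectors_span_dot (u : vec R) :
  (forall i, dot u (a i - a ord0) = 0) -> u = 0.
Proof.
move=> u0; apply: trmx_inj; rewrite trmx0; apply: edge_vectors_span => i.
by apply/matrixP => ? ?; rewrite !ord1 -dot_mul dotC u0 mxE.
Qed.

(** Every function on the vertices extends to an affine function; [u] is its
    gradient. *)
Lemma barycentric_gradient (f : 'I_4 -> R) :
  exists u : vec R, forall i j, dot u (a j - a i) = f j - f i.
Proof.
pose D := \matrix_(i < 3) (a (lift ord0 i) - a ord0).
have uD : D \in unitmx by rewrite -row_free_unit.
exists (invmx D *m \col_i (f (lift ord0 i) - f ord0))^T.
set u := (X in dot X^T).
have u0 i : dot u^T (a i - a ord0) = f i - f ord0.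
  case: (unliftP ord0 i) => [j ->|->]; last by rewrite !subrr dotC dot0l.
  have := congr1 (fun X : 'cV_3 => X j 0)
    (mulKVmx uD (\col_i (f (lift ord0 i) - f ord0))).
  rewrite -/u mxE [RHS]mxE => <-; rewrite dotC; apply: eq_bigr => l _.
  by rewrite !mxE.
by move=> i j; rewrite (_ : a j - a i = (a j - a ord0) - (a i - a ord0));
  [rewrite dotDr dotNr !u0; ring | rewrite opprB addrA subrK].
Qed.

Lemma polarization (H : 'M[R]_3) (u v : vec R) : H^T = H ->
  dot (u *m H) v *+ 2 =
  dot (u *m H) u + dot (v *m H) v - dot ((u - v) *m H) (u - v).
Proof.
move=> sH; have HC : dot (v *m H) u = dot (u *m H) v.
  by rewrite [RHS]dotC !dot_mul trmx_mul sH mulmxA.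
by rewrite mulmxBl !(dotDl, dotNl, dotDr, dotNr) HC; ring.
Qed.

(** Six numbers determine a quadratic form: by polarization, its values on the
    six edges give its values on all pairs of vectors of the basis. *)
Lemma symmetric_form_eq0 (H : 'M[R]_3) : H^T = H ->
  (forall i j, dot ((a j - a i) *m H) (a j - a i) = 0) -> H = 0.
Proof.
move=> sH H0; apply: edge_vectors_span => i; apply: edge_vectors_span_dot => j.
set u := a i - a ord0; set v := a j - a ord0.
have /eqP := polarization u v sH; rewrite !H0 (_ : u - v = a i - a j) ?H0.
  by rewrite !addr0 subrr mulrn_eq0 /= => /eqP.
by rewrite /u /v opprB addrA subrK.
Qed.

(** Relative to the barycenter the vertices have sum zero, so the centroid of a
    face is opposite to the remaining vertex. *)
Lemma face_centroid F :
  3^-1 *: \sum_i (fvertex a F i - barycenter a) = - 3^-1 *: y F.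
Proof.
have := sum_centered; rewrite (bigD1_ord F) //= => /eqP.
by rewrite addrC addr_eq0 => /eqP ->; rewrite scalerN scaleNr.
Qed.

Definition face_normal F : vec R :=
  cross (fvertex a F 1 - fvertex a F 0) (fvertex a F 2 - fvertex a F 0).

(** The gradients [u] and [w] of two barycentric coordinates are dual to the two
    sides of the face, hence [dot (cross u w) (cross e1 e2) = 1] by the identity
    of Binet and Cauchy. *)
Lemma face_normal_neq0 F : face_normal F != 0.
Proof.
have [u uP] := barycentric_gradient (fun i => (i == lift F 1)%:R).
have [w wP] := barycentric_gradient (fun i => (i == lift F 2)%:R).
have : dot (cross u w) (face_normal F) = 1.
  transitivity (dot u (fvertex a F 1 - fvertex a F 0)
      * dot w (fvertex a F 2 - fvertex a F 0)
    - dot u (fvertex a F 2 - fvertex a F 0)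
      * dot w (fvertex a F 1 - fvertex a F 0)).
    by rewrite !dotE /face_normal !crossE; ring.
  rewrite !uP !wP !(inj_eq lift_inj) /=.
  by rewrite !subr0 mul1r mul0r subr0.
by move=> uwn; apply/eqP => n0; move/eqP: uwn; rewrite n0 dotC dot0l eq_sym oner_eq0.
Qed.

(** A vector is determined by its product with the unit normal, which gives the
    tangential part, and by its flux through the face. *)
Lemma orthogonal_face_eq0 F (n w : vec R) : outward_unit_normal a F n ->
  cross w n = 0 -> dot w (face_normal F) = 0 -> w = 0.
Proof.
move=> [n1 nF _] wn wN.
have nn := dot_unit n1.
have parallel z : cross z n = 0 -> z = dot z n *: n.
  move=> zn; have := cross_cross z n; rewrite zn nn scale1r cross0r.
  by move/esym/eqP; rewrite subr_eq0 => /eqP.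
have NE := parallel (face_normal F); rewrite {1}/face_normal cross_crossl in NE.
rewrite ![dot (_ - _) n]dotC !nF !scale0r subrr in NE.
have {}NE := NE erefl.
have := parallel _ wn => wE; move: wN; rewrite {1}wE NE dotZl dotZr nn mulr1.
move/eqP; rewrite mulf_eq0 => /orP[/eqP wn0|/eqP Nn]; first by rewrite wE wn0 scale0r.
by have := face_normal_neq0 F; rewrite NE Nn scale0r eqxx.
Qed.

(** Edges are listed with one orientation only; this recovers all ordered
    pairs. *)
Lemma for_all_pairs (P : 'I_4 -> 'I_4 -> Prop) :
  (forall i, P i i) -> (forall i j, P i j -> P j i) ->
  (forall e : edge, P (val e).1 (val e).2) -> forall i j, P i j.
Proof.
move=> P0 PC Pe i j; case: (ltngtP i j) => [lij|lji|/val_inj ->] //.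
  exact: (Pe (exist _ (i, j) lij)).
exact/PC/(Pe (exist _ (j, i) lji)).
Qed.

(** The uniqueness argument. Taking the scalar product with the normal gives
    [s = 0]. Since the circulations vanish, Stokes shows that the curl has no flux
    through the faces; its tangential part vanishes too, so it is zero at the
    centroids of the four faces. Being affine it is zero, whence [q = 0] and
    [M = 0]. The remaining field [b + y *m H] is a gradient: its tangential
    component has no slope on the edges, so [H = 0], and no mean, so [b = 0]. *)
Lemma system_kernel (k : nat) (n : 'I_4 -> vec R)
    (nP : forall F, outward_unit_normal a F (n F))
    (b q : vec R) (H M : 'M[R]_3) (s : 'rV[R]_4) :
  H^T = H -> \tr M = 0 ->
  (forall e : edge, edge_circulation b H q M (y (val e).1) (y (val e).2) = 0) ->
  (forall e : edge, edge_variation k b H q M (y (val e).1) (y (val e).2) = 0) ->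
  (forall F, cross (curl_field q M (- 3^-1 *: y F)) (n F) + s 0 F *: n F = 0) ->
  [/\ b = 0, H = 0, q = 0, M = 0 & s = 0].
Proof.
move=> sH trM circ0 sec0 face0.
have yB i j : y j - y i = a j - a i by rewrite /y opprB addrA subrK.
have {}circ0 : forall i j, edge_circulation b H q M (y i) (y j) = 0.
  apply: for_all_pairs => [i|i j|//].
    by rewrite /edge_circulation subrr dotC dot0l.
  by rewrite edge_circulationC => /eqP; rewrite oppr_eq0 => /eqP.
have s0 F : s 0 F = 0.
  have [n1 _ _] := nP F.
  have := congr1 (fun w : vec R => dot w (n F)) (face0 F).
  by rewrite /= dotDl dot_crossr dotZl add0r dot0l (dot_unit n1) mulr1.
have curl0 F : curl_field q M (- 3^-1 *: y F) = 0.
  apply: (orthogonal_face_eq0 (nP F)).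
    by have := face0 F; rewrite s0 scale0r addr0.
  have := circulation_face_boundary b q M (y (lift F 0)) (y (lift F 1))
    (y (lift F 2)) sH.
  rewrite !circ0 !addr0 !yB -/(face_normal F) -face_centroid sum3E.
  by move/esym/eqP; rewrite mulf_eq0 invr_eq0 pnatr_eq0 => /eqP.
(* Adding the four equations isolates the constant part of the curl. *)
have q0 : q = 0.
  have : \sum_F curl_field q M (- 3^-1 *: y F) = 0 by apply: big1.
  rewrite /curl_field sumrB sumr_const card_ord -mulmx_suml -scaler_sumr.
  rewrite sum_centered scaler0 mul0mx sub0r => /eqP.
  by rewrite oppr_eq0 -mulrnA -scaler_nat scaler_eq0 pnatr_eq0 => /eqP.
have M0 : M = 0.
  suff /eqP : M *+ 3 = 0.
    by rewrite -scaler_nat scaler_eq0 pnatr_eq0 => /eqP.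
  apply: edge_vectors_span => i; rewrite -yB mulmxBl.
  suff yM j : y j *m (M *+ 3) = 0 by rewrite !yM subrr.
  have := curl0 j; rewrite /curl_field q0 mul0rn subr0 trM raddf0 sub0r mulmxN.
  rewrite -scalemxAl => /eqP; rewrite oppr_eq0 scaler_eq0 oppr_eq0 invr_eq0.
  by rewrite pnatr_eq0 => /eqP.
have fE u : shape_field b H q M u = b + u *m H.
  by rewrite /shape_field q0 M0 mulmx0 addr0 cross0r addr0.
have H0 : H = 0.
  apply: symmetric_form_eq0 => //.
  apply: for_all_pairs => [i|i j|e].
  - by rewrite subrr dotC dot0l.
  - by rewrite -(opprB (a j)) mulNmx dotNl dotNr opprK.
  - have := sec0 e; rewrite /edge_variation /edge_slope !fE !yB.
    by rewrite opprD addrACA subrr add0r -mulmxBl yB; case: ifP.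
split=> //; last by apply/rowP => F; rewrite s0 mxE.
apply: edge_vectors_span_dot => i; have := circ0 ord0 i.
by rewrite /edge_circulation fE H0 mulmx0 addr0 yB.
Qed.

End Tetrahedron.

(** * A square linear system *)

Lemma injective_linear_surjective (K : fieldType) (U V : vectType K)
    (f : {linear U -> V}) :
  dim U = dim V -> injective f -> forall v, exists u, f u = v.
Proof.
move=> dUV injf v; pose g := linfun f.
have kg : lker g == 0%VS.
  by apply/lker0P => x y; rewrite !lfunE; exact: injf.
have /vspaceP/(_ v) : limg g = fullv.
  apply/eqP; rewrite eqEdim subvf limg_dim_eq ?(eqP kg) ?capv0 //.
  by rewrite !dimvf dUV leqnn.
by rewrite memvf => /memv_imgP[u _ ->]; exists u; rewrite lfunE.
Qed.

Lemma card_edge : #|{: edge}| = 6.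
Proof.
rewrite card_sig -sum1_card big_mkcond /=.
rewrite -(pair_bigA _ (fun i j : 'I_4 => if (i < j)%N then 1 else 0)%N) /=.
by rewrite !big_ord_recl !big_ord0.
Qed.

Section Linearity.
Variable R : realType.
Implicit Types (b q y z : 'rV[R]_3) (H M : 'M[R]_3).

Lemma shape_field_linear c b1 b2 H1 H2 q1 q2 M1 M2 y :
  shape_field (c *: b1 + b2) (c *: H1 + H2) (c *: q1 + q2) (c *: M1 + M2) y =
  c *: shape_field b1 H1 q1 M1 y + shape_field b2 H2 q2 M2 y.
Proof.
have qE : c *: q1 + q2 + y *m (c *: M1 + M2) =
    c *: (q1 + y *m M1) + (q2 + y *m M2).
  by rewrite mulmxDr -scalemxAr scalerDr addrACA.
rewrite /shape_field qE; move: (q1 + _) (q2 + _) => r1 r2.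
rewrite crossDr crossZr mulmxDr -scalemxAr !scalerDr.
rewrite (addrACA (c *: b1)); exact: addrACA.
Qed.

Lemma curl_field_linear c q1 q2 M1 M2 y :
  curl_field (c *: q1 + q2) (c *: M1 + M2) y =
  c *: curl_field q1 M1 y + curl_field q2 M2 y.
Proof.
have ME : (\tr (c *: M1 + M2))%:M - (c *: M1 + M2) *+ 3 =
    c *: ((\tr M1)%:M - M1 *+ 3) + ((\tr M2)%:M - M2 *+ 3).
  rewrite mxtraceD mxtraceZ raddfD /= -scale_scalar_mx scalerBr mulrnDl.
  by rewrite opprD scalerMnr addrACA.
rewrite /curl_field ME mulmxDr -scalemxAr scalerBr.
move: (y *m _) (y *m _) => w1 w2.
rewrite mulrnDl scalerMnr opprD; exact: addrACA.
Qed.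

Lemma edge_circulation_linear c b1 b2 H1 H2 q1 q2 M1 M2 y z :
  edge_circulation (c *: b1 + b2) (c *: H1 + H2) (c *: q1 + q2) (c *: M1 + M2) y z =
  c * edge_circulation b1 H1 q1 M1 y z + edge_circulation b2 H2 q2 M2 y z.
Proof. by rewrite /edge_circulation shape_field_linear dotDl dotZl. Qed.

Lemma edge_variation_linear k c b1 b2 H1 H2 q1 q2 M1 M2 y z :
  edge_variation k (c *: b1 + b2) (c *: H1 + H2) (c *: q1 + q2) (c *: M1 + M2)
      y z =
  c * edge_variation k b1 H1 q1 M1 y z + edge_variation k b2 H2 q2 M2 y z.
Proof.
rewrite /edge_variation /edge_slope !shape_field_linear; case: ifP => _.
  by rewrite mulmxDr dotDl -scalemxAr; congr (_ + _); exact: dotZl.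
move: (shape_field b1 _ _ _ _) (shape_field b1 _ _ _ _).
move: (shape_field b2 _ _ _ _) (shape_field b2 _ _ _ _).
move: (z - y) => d w1 w2 w3 w4.
by rewrite !(dotDl, dotNl, dotZl); ring.
Qed.

End Linearity.

Section System.
Variables (R : realType) (a : 'I_4 -> vec R) (n : 'I_4 -> vec R) (k : nat).
Hypothesis Knd : nondegenerate_tet a.
Hypothesis nP : forall F, outward_unit_normal a F (n F).

Let y i : vec R := a i - barycenter a.

Definition skew (H : 'M[R]_3) : vec R :=
  \row_i (H (i + 1) (i + 2) - H (i + 2) (i + 1)).

Lemma skew_eq0 (H : 'M[R]_3) : skew H = 0 -> H^T = H.
Proof.
move=> /rowP H0; have := H0 0; have := H0 1; have := H0 2.
rewrite !mxE !addI3E => /eqP; rewrite subr_eq0 => /eqP h2.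
move=> /eqP; rewrite subr_eq0 => /eqP h1 /eqP; rewrite subr_eq0 => /eqP h0.
apply/matrixP => i j; rewrite mxE.
have I3 (l : 'I_3) : [\/ l = 0, l = 1 | l = 2].
  by case: l => -[|[|[|l]]] // ltl; [apply: Or31|apply: Or32|apply: Or33];
    apply: val_inj.
by case: (I3 i) => ->; case: (I3 j) => ->; rewrite ?h0 ?h1 ?h2.
Qed.

(** The degrees of freedom completed to a system of 28 equations in 28
    unknowns. The last two components normalize the unknowns: [H] is symmetric
    and [M] has trace zero. The auxiliary unknown [s] adds a normal component to
    the face values, which lie in planes; thus the target is the whole space of
    vectors on each face, and no bases of these planes have to be chosen. *)
Definition system (x : 'rV[R]_3 * 'M[R]_3 * 'rV[R]_3 * 'M[R]_3 * 'rV[R]_4) :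
    {ffun edge -> R^o} * {ffun edge -> R^o} * {ffun 'I_4 -> 'rV[R]_3}
    * 'rV[R]_3 * R^o :=
  let: (b, H, q, M, s) := x in
  ([ffun e : edge => edge_circulation b H q M (y (val e).1) (y (val e).2)],
   [ffun e : edge => edge_variation k b H q M (y (val e).1) (y (val e).2)],
   [ffun F => cross (curl_field q M (- 3^-1 *: y F)) (n F) + s 0 F *: n F],
   skew H, \tr M).

Lemma system_linear : linear system.
Proof.
move=> c [[[[b1 H1] q1] M1] s1] [[[[b2 H2] q2] M2] s2].
rewrite /system /=; congr (_, _, _, _, _).
- by apply/ffunP => e; rewrite !ffunE edge_circulation_linear.
- by apply/ffunP => e; rewrite !ffunE edge_variation_linear.
- apply/ffunP => F; rewrite !ffunE curl_field_linear crossDl crossZl.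
  have -> : (c *: s1 + s2) 0 F = c * s1 0 F + s2 0 F by rewrite !mxE.
  by rewrite scalerDl -scalerA addrACA -scalerDr.
- by apply/rowP => i; rewrite !mxE; ring.
- by rewrite mxtraceD mxtraceZ.
Qed.

HB.instance Definition _ := GRing.isLinear.Build R _ _ _ system system_linear.

Lemma system_inj : injective system.
Proof.
move=> u v uv; apply/eqP; rewrite -subr_eq0; apply/eqP.
have : system (u - v) = 0 by rewrite raddfB /= uv subrr.
move: (u - v) => [[[[b H] q] M] s] /= [] /ffunP e1 /ffunP e2 /ffunP e3 e4 e5.
have [|||] := system_kernel Knd (k := k) nP (b := b) (q := q) (s := s)
  (skew_eq0 e4) e5.
- by move=> e; have := e1 e; rewrite !ffunE.
- by move=> e; have := e2 e; rewrite !ffunE.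
- by move=> e; have := e3 e; rewrite !ffunE.
by move=> -> -> -> -> ->.
Qed.

Definition solves (m beta : edge -> R) (g : 'I_4 -> vec R)
    (x : 'rV[R]_3 * 'M[R]_3 * 'rV[R]_3 * 'M[R]_3) : Prop :=
  let: (b, H, q, M) := x in
  [/\ H^T = H, \tr M = 0,
    forall e : edge, edge_circulation b H q M (y (val e).1) (y (val e).2) = m e,
    forall e : edge,
      edge_variation k b H q M (y (val e).1) (y (val e).2) = beta e &
    forall F, cross (curl_field q M (- 3^-1 *: y F)) (n F) = g F].

(** The system is injective between spaces of dimension 28, hence bijective. The
    auxiliary unknown vanishes when the data on the faces are tangential. *)
Lemma solves_unique m beta g : (forall F, dot (g F) (n F) = 0) ->
  exists! x, solves m beta g x.
Proof.
move=> gP.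
pose rhs : {ffun edge -> R^o} * {ffun edge -> R^o} * {ffun 'I_4 -> 'rV[R]_3}
    * 'rV[R]_3 * R^o := ([ffun e => m e], [ffun e => beta e], [ffun F => g F], 0, 0).
have solE b H q M s : system (b, H, q, M, s) = rhs <->
    solves m beta g (b, H, q, M) /\ s = 0.
  split=> [|[[sH trM e1 e2 e3] ->]]; last first.
    congr (_, _, _, _, _) => //.
    - by apply/ffunP => e; rewrite !ffunE.
    - by apply/ffunP => e; rewrite !ffunE.
    - by apply/ffunP => F; rewrite !ffunE mxE scale0r addr0.
    - by apply/rowP => i; rewrite !mxE -[in X in X - _]sH mxE subrr.
  move=> [] /ffunP e1 /ffunP e2 /ffunP e3 e4 e5.
  have s0 F : s 0 F = 0.
    have [n1 _ _] := nP F.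
    have := e3 F; rewrite !ffunE => /(congr1 (fun w : vec R => dot w (n F))).
    by rewrite /= dotDl dot_crossr dotZl add0r gP (dot_unit n1) mulr1.
  split; last by apply/rowP => F; rewrite s0 mxE.
  split=> //; first exact: skew_eq0.
  - by move=> e; have := e1 e; rewrite !ffunE.
  - by move=> e; have := e2 e; rewrite !ffunE.
  - by move=> F; have := e3 F; rewrite !ffunE s0 scale0r addr0.
have dims : dim ('rV[R]_3 * 'M[R]_3 * 'rV[R]_3 * 'M[R]_3 * 'rV[R]_4)%type =
    dim ({ffun edge -> R^o} * {ffun edge -> R^o} * {ffun 'I_4 -> 'rV[R]_3}
         * 'rV[R]_3 * R^o)%type.
  transitivity (#|{: edge}| * 1 + #|{: edge}| * 1 + #|'I_4| * (1 * 3)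
    + 1 * 3 + 1)%N => //.
  by rewrite card_edge card_ord.
have [[[[[b H] q] M] s] /solE[sol s0]] :=
  injective_linear_surjective dims system_inj rhs.
exists (b, H, q, M); split=> // -[[[b' H'] q'] M'] sol'.
have : system (b, H, q, M, 0) = system (b', H', q', M', 0).
  by rewrite (solE _ _ _ _ _).2 // (solE _ _ _ _ _).2.
by move/system_inj => [-> -> -> ->].
Qed.

End System.

(** * Polynomial vector fields *)

Section Morphism.
Variables (A B : comNzRingType) (f : {rmorphism A -> B}).
Implicit Types (b q y u v : 'rV[A]_3) (H M : 'M[A]_3).

Lemma map_cross u v :
  map_mx f (cross u v) = cross (map_mx f u) (map_mx f v).
Proof. by apply/rowP => i; rewrite !mxE rmorphB !rmorphM. Qed.

Lemma map_shape_field b H q M y : map_mx f (shape_field b H q M y) =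
  shape_field (map_mx f b) (map_mx f H) (map_mx f q) (map_mx f M) (map_mx f y).
Proof. by rewrite /shape_field !map_mxD map_cross map_mxD !map_mxM. Qed.

Lemma map_curl_field q M y : map_mx f (curl_field q M y) =
  curl_field (map_mx f q) (map_mx f M) (map_mx f y).
Proof.
rewrite /curl_field map_mxB map_mxM map_mxB map_scalar_mx trace_map_mx.
by rewrite !raddfMn.
Qed.

End Morphism.

Section Quadratic.
Variable A : comNzRingType.
Implicit Types (b y : 'rV[A]_3) (H : 'M[A]_3) (h p : A).

(** In use [h] is one half, which has to be a parameter since a polynomial ring
    has no division. *)
Definition quadratic h p b H y : A := p + dot y b + h * dot (y *m H) y.

Lemma quadraticD h p1 p2 b1 b2 H1 H2 y :
  quadratic h p1 b1 H1 y + quadratic h p2 b2 H2 y =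
  quadratic h (p1 + p2) (b1 + b2) (H1 + H2) y.
Proof. by rewrite /quadratic mulmxDr dotDr dotDl; ring. Qed.

Lemma quadraticZ x h p b H y :
  x * quadratic h p b H y = quadratic h (x * p) (x *: b) (x *: H) y.
Proof. by rewrite /quadratic -scalemxAr dotZr dotZl; ring. Qed.

Lemma quadratic0 h p b y : quadratic h p b 0 y = p + dot y b.
Proof. by rewrite /quadratic mulmx0 dot0l mulr0 addr0. Qed.

Lemma quadratic_mul h p1 p2 b1 b2 y : h *+ 2 = 1 ->
  quadratic h p1 b1 0 y * quadratic h p2 b2 0 y =
  quadratic h (p1 * p2) (p1 *: b2 + p2 *: b1) (b1^T *m b2 + b2^T *m b1) y.
Proof.
move=> h2; rewrite !quadratic0 /quadratic.
have E u v : dot (y *m (u^T *m v)) y = dot y u * dot y v.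
  have -> : y *m (u^T *m v) = dot y u *: v.
    rewrite mulmxA; apply/rowP => i; rewrite !mxE big_ord1 !mxE; congr (_ * _).
    by apply: eq_bigr => j _; rewrite mxE.
  by rewrite dotZl (dotC v).
rewrite mulmxDr dotDl dotDr !dotZr !E (mulrC (dot y b2)) -mulr2n mulrnAr -mulrnAl.
by rewrite h2; ring.
Qed.

End Quadratic.

Section Polynomials.
Variables (R : realType) (c : vec R).
Local Notation P := (poly3 R).
Local Notation C := (map_mx (@mpolyC 3 R)).
Local Notation Y := (centered c).

Lemma centeredE i : Y 0 i = mpolyX R (mnm1 i) - mpolyC 3 (c 0 i).
Proof. by rewrite mxE. Qed.

Lemma mderiv_centered i j : mderiv i (Y 0 j) = (i == j)%:R.
Proof.
rewrite centeredE mderivB mderivC subr0 mderivX mnmE eq_sym.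
case: eqP => [->|_]; last by rewrite scale0r.
by rewrite scale1r (_ : mnm_sub _ _ = mnm0) ?mpolyX0 //; apply/mnmP => l;
  rewrite mnmBE subnn mnm0E.
Qed.

Lemma constE m n (X : 'M[R]_(m, n)) i j : C X i j = mpolyC 3 (X i j).
Proof. by rewrite mxE. Qed.

(** The curl of the gradient part vanishes because [H] is symmetric. *)
Lemma curl_shape_field (b q : vec R) (H M : 'M[R]_3) : H^T = H ->
  curl (shape_field (C b) (C H) (C q) (C M) Y) = curl_field (C q) (C M) Y.
Proof.
move=> /matrixP sH.
have sH10 := sH 0 1; have sH20 := sH 0 2; have sH21 := sH 1 2.
rewrite !mxE in sH10 sH20 sH21.
have D := (mderivB, mderivD, mderivM, mderiv_centered, mderivC).
apply: row3P; rewrite mxE !addI3E !shape_fieldE !affineE !curl_fieldE !constE !D /=;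
  rewrite ?sH10 ?sH20 ?sH21; ring.
Qed.

Definition quadratic_poly (p : R) (b : vec R) (H : 'M[R]_3) : P :=
  quadratic (mpolyC 3 2^-1) (mpolyC 3 p) (C b) (C H) Y.

Lemma mpolyC_half : mpolyC 3 2^-1 *+ 2 = 1 :> P.
Proof. by rewrite -mpolyCMn (_ : 2^-1 *+ 2 = 1) ?mpolyC1 //; field. Qed.

Lemma grad_quadratic p0 b H : H^T = H ->
  grad (quadratic_poly p0 b H) = C b + Y *m C H.
Proof.
move=> /matrixP sH.
have sH10 := sH 0 1; have sH20 := sH 0 2; have sH21 := sH 1 2.
rewrite !mxE in sH10 sH20 sH21.
have D := (mderivB, mderivD, mderivM, mderiv_centered, mderivC).
have half (x : P) : mpolyC 3 2^-1 * (x + x) = x.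
  by rewrite -mulr2n mulrnAr -mulrnAl mpolyC_half mul1r.
have YH i : (Y *m C H) 0 i =
    Y 0 0 * C H 0 i + Y 0 1 * C H 1 i + Y 0 2 * C H 2 i by rewrite mxE sum3E.
have E i : (C b + Y *m C H) 0 i =
    C b 0 i + mpolyC 3 2^-1 * ((Y *m C H) 0 i + (Y *m C H) 0 i).
  by rewrite half mxE.
apply: row3P; rewrite mxE E /quadratic_poly /quadratic !dotE !YH !constE !D /=;
  rewrite ?sH10 ?sH20 ?sH21; ring.
Qed.

(** Polynomials of degree at most two expanded at [c], with a condition [Hs] on
    the quadratic part; degree at most one is the case [H = 0]. *)
Definition quadratic_rep (Hs : 'M[R]_3 -> Prop) (p : P) :=
  exists p0 b H, [/\ H^T = H, Hs H & p = quadratic_poly p0 b H].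

Notation affine_rep := (quadratic_rep (fun H => H = 0)).
Notation symmetric_rep := (quadratic_rep (fun=> True)).

Lemma affine_repE p0 b : affine_rep (quadratic_poly p0 b 0).
Proof. by exists p0, b, 0; rewrite trmx0. Qed.

Lemma affine_symmetric_rep p : affine_rep p -> symmetric_rep p.
Proof. by move=> [p0 [b [H [sH _ ->]]]]; exists p0, b, H. Qed.

Lemma quadratic_rep_comb (Hs : 'M[R]_3 -> Prop) x p1 p2 :
  (forall y H1 H2, Hs H1 -> Hs H2 -> Hs (y *: H1 + H2)) ->
  quadratic_rep Hs p1 -> quadratic_rep Hs p2 -> quadratic_rep Hs (x *: p1 + p2).
Proof.
move=> HsD [a1 [b1 [H1 [s1 h1 ->]]]] [a2 [b2 [H2 [s2 h2 ->]]]].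
exists (x * a1 + a2), (x *: b1 + b2), (x *: H1 + H2); split.
- by apply/matrixP => i j; rewrite -[in RHS]s1 -[in RHS]s2 !mxE.
- exact: HsD.
- rewrite -mul_mpolyC /quadratic_poly quadraticZ quadraticD.
  by rewrite mpolyCD mpolyCM !map_mxD !map_mxZ.
Qed.

Lemma affine_rep_mul p1 p2 :
  affine_rep p1 -> affine_rep p2 -> symmetric_rep (p1 * p2).
Proof.
move=> [a1 [b1 [_ [_ -> ->]]]] [a2 [b2 [_ [_ -> ->]]]].
exists (a1 * a2), (a1 *: b2 + a2 *: b1), (b1^T *m b2 + b2^T *m b1); split=> //.
  by rewrite raddfD /= !trmx_mul !trmxK addrC.
rewrite /quadratic_poly !map_mx0 (quadratic_mul _ _ _ _ _ mpolyC_half).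
congr quadratic.
- by rewrite mpolyCM.
- by rewrite map_mxD !map_mxZ.
- by rewrite map_mxD !map_mxM !map_trmx.
Qed.

Lemma affine_rep_const x : affine_rep (mpolyC 3 x).
Proof.
have -> : mpolyC 3 x = quadratic_poly x 0 0; last exact: affine_repE.
by rewrite /quadratic_poly !map_mx0 quadratic0 dotC dot0l addr0.
Qed.

Lemma affine_rep_X i : affine_rep (mpolyX R (mnm1 i)).
Proof.
have -> : mpolyX R (mnm1 i) = quadratic_poly (c 0 i) (delta_mx 0 i) 0.
  rewrite /quadratic_poly map_mx0 quadratic0 map_delta_mx.
  rewrite -[LHS](subrK (mpolyC 3 (c 0 i))) -centeredE addrC; congr (_ + _).
  rewrite /dot (bigD1 i) //= [delta_mx _ _ _ _]mxE !eqxx mulr1 big1 ?addr0 // => j ji.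
  by rewrite [delta_mx _ _ _ _]mxE (negPf ji) andbF mulr0.
exact: affine_repE.
Qed.

Lemma monomial_ind (Q : P -> Prop) (d : nat) p : (msize p <= d.+1)%N ->
  (forall x p1 p2, Q p1 -> Q p2 -> Q (x *: p1 + p2)) -> Q 0 ->
  (forall m, (mdeg m <= d)%N -> Q (mpolyX R m)) -> Q p.
Proof.
move=> dp Qcomb Q0 Qm; rewrite [p]mpolyE big_seq; apply: big_rec => // m p' mp.
by apply: Qcomb; apply: Qm; rewrite -ltnS (leq_trans (msize_mdeg_lt mp)).
Qed.

Lemma affine_rep_comb x p1 p2 :
  affine_rep p1 -> affine_rep p2 -> affine_rep (x *: p1 + p2).
Proof. by apply: quadratic_rep_comb => y _ _ -> ->; rewrite scaler0 addr0. Qed.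

Lemma affine_rep_monomial m : (mdeg m <= 1)%N -> affine_rep (mpolyX R m).
Proof.
rewrite leq_eqVlt => /orP[/mdeg1P[i /eqP ->]|]; first exact: affine_rep_X.
rewrite ltnS leqn0 mdeg_eq0 => /eqP ->; rewrite mpolyX0 -mpolyC1.
exact: affine_rep_const.
Qed.

Lemma deg1_affine_rep p : deg_le 1 p -> affine_rep p.
Proof.
move=> dp; apply: (monomial_ind dp) => [x p1 p2||m].
- exact: affine_rep_comb.
- by rewrite -mpolyC0; exact: affine_rep_const.
- exact: affine_rep_monomial.
Qed.

Lemma deg2_symmetric_rep p : deg_le 2 p -> symmetric_rep p.
Proof.
move=> dp; apply: (monomial_ind dp) => [x p1 p2||m dm].
- exact: quadratic_rep_comb.
- by rewrite -mpolyC0; apply/affine_symmetric_rep/affine_rep_const.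
have [->|m_neq0] := eqVneq m mnm0.
  by apply/affine_symmetric_rep/affine_rep_monomial; rewrite mdeg0.
have /existsP[i mi] : [exists i, (0 < m i)%N].
  apply: contraR m_neq0 => /existsPn m0; apply/eqP/mnmP => i.
  by rewrite mnm0E; apply/eqP; rewrite -leqn0 leqNgt.
have mE : m = mnm_add (mnm1 i) (mnm_sub m (mnm1 i)).
  rewrite addmC submK //; apply/mnm_lepP => j; rewrite mnm1E.
  by case: eqP => [<-|].
rewrite mE mpolyXD; apply: affine_rep_mul; first exact: affine_rep_X.
apply: affine_rep_monomial.
by move: dm; rewrite {1}mE mdegD mdeg1 add1n ltnS.
Qed.

End Polynomials.

Section Degree.
Variables (R : realType) (c : vec R).
Local Notation C := (map_mx (@mpolyC 3 R)).
Local Notation Y := (centered c).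

Lemma deg_leD d (p1 p2 : poly3 R) : deg_le d p1 -> deg_le d p2 -> deg_le d (p1 + p2).
Proof.
move=> d1 d2; rewrite /deg_le (leq_trans (msizeD_le _ _)) // geq_max.
by rewrite [X in X && _]d1 [X in _ && X]d2.
Qed.

Lemma deg_leM d1 d2 (p1 p2 : poly3 R) :
  deg_le d1 p1 -> deg_le d2 p2 -> deg_le (d1 + d2) (p1 * p2).
Proof.
rewrite /deg_le => h1 h2.
have [->|p1n] := eqVneq p1 0; first by rewrite mul0r msize0.
have [->|p2n] := eqVneq p2 0; first by rewrite mulr0 msize0.
rewrite msizeM // -subn1 leq_subLR add1n -addSn -addnS; exact: leq_add.
Qed.

Lemma deg_le_const x d : deg_le d (mpolyC 3 x : poly3 R).
Proof. by rewrite /deg_le msizeC; case: (x != 0). Qed.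

Lemma deg_le_centered i : deg_le 1 (Y 0 i).
Proof.
rewrite centeredE -mpolyCN; apply: deg_leD; last exact: deg_le_const.
by rewrite /deg_le msizeX mdeg1.
Qed.

Lemma deg_le_sum d (F : 'I_3 -> poly3 R) :
  (forall i, deg_le d (F i)) -> deg_le d (\sum_i F i).
Proof. by move=> dF; rewrite sum3E; do 2 apply: deg_leD => //. Qed.

Lemma deg_le_affine (b : vec R) : deg_le 1 (dot Y (C b)).
Proof.
apply: deg_le_sum => i; rewrite constE.
by apply: (@deg_leM 1 0); [exact: deg_le_centered|exact: deg_le_const].
Qed.

Lemma deg_le_quadratic p0 b H : deg_le 2 (quadratic_poly c p0 b H).
Proof.
rewrite /quadratic_poly /quadratic; apply: deg_leD; first apply: deg_leD.
- exact: deg_le_const.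
- exact: (leq_trans (deg_le_affine b)).
- apply: (@deg_leM 0 2); first exact: deg_le_const.
  apply: deg_le_sum => i; apply: (@deg_leM 1 1).
    rewrite mxE; apply: deg_le_sum => j; rewrite constE.
    by apply: (@deg_leM 1 0); [exact: deg_le_centered|exact: deg_le_const].
  exact: deg_le_centered.
Qed.

Lemma peval_affine_poly p0 b x :
  peval (quadratic_poly c p0 b 0) x = p0 + dot (x - c) b.
Proof.
rewrite /quadratic_poly map_mx0 quadratic0 /peval mevalD mevalC !dotE.
by rewrite !mevalD !mevalM !centeredE !constE !mevalB !mevalXU !mevalC !mxE.
Qed.

Lemma deg_le_affine_poly p0 b : deg_le 1 (quadratic_poly c p0 b 0).
Proof.
rewrite /quadratic_poly map_mx0 quadratic0.
by apply: deg_leD; [exact: deg_le_const|exact: deg_le_affine].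
Qed.

End Degree.

Section Shape.
Variables (R : realType) (a : 'I_4 -> vec R).
Local Notation c := (barycenter a).
Local Notation C := (map_mx (@mpolyC 3 R)).
Local Notation Y := (centered c).

Definition shape_vpoly (b : vec R) (H : 'M[R]_3) (q : vec R) (M : 'M[R]_3) : vpoly R :=
  shape_field (C b) (C H) (C q) (C M) Y.

(** The normalized coordinates of a shape function. The potential contributes
    [b] and [H]. A multiple of the identity can be subtracted from [M] without
    changing the field, so the trace can be taken to be zero. *)
Lemma shape_spaceP k v : k = 0%N \/ k = 1%N ->
  shape_space a k v <-> exists b H q M,
    [/\ H^T = H, \tr M = 0, k = 0%N -> H = 0 & v = shape_vpoly b H q M].
Proof.
move=> k01; split; last first.
  move=> [b [H [q [M [sH _ kH ->]]]]].
  exists (quadratic_poly c 0 b H), (C q + Y *m C M); split.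
  - case: k01 kH => -> kH; last exact: deg_le_quadratic.
    by rewrite kH //; exact: deg_le_affine_poly.
  - move=> i; rewrite mxE; apply: deg_leD; first by rewrite constE; exact: deg_le_const.
    rewrite mxE; apply: deg_le_sum => j; rewrite constE.
    by apply: (@deg_leM _ 1 0); [exact: deg_le_centered|exact: deg_le_const].
  - by rewrite grad_quadratic.
move=> [p [q [dp dq ->]]].
have [p0 [b [H [sH kH ->]]]] : exists p0 b H,
    [/\ H^T = H, k = 0%N -> H = 0 & p = quadratic_poly c p0 b H].
  case: k01 dp => -> dp.
    have [p0 [b [H [sH H0 pE]]]] := deg1_affine_rep c dp.
    by exists p0, b, H.
  have [p0 [b [H [sH _ pE]]]] := deg2_symmetric_rep c dp.
  by exists p0, b, H.
have /fin_all_exists[q0 /fin_all_exists[w qE]] : forall i, exists q0 w,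
    q 0 i = quadratic_poly c q0 w 0.
  move=> i; have [q0 [w [_ [_ -> qE]]]] := deg1_affine_rep c (dq i).
  by exists q0, w.
pose M : 'M[R]_3 := \matrix_(j, i) w i 0 j.
exists b, H, (\row_i q0 i), (M - (3^-1 * \tr M)%:M); split=> //.
  rewrite raddfB /= mxtrace_scalar -mulrnAl (_ : 3^-1 *+ 3 = 1); last by field.
  by rewrite mul1r subrr.
rewrite grad_quadratic // /shape_vpoly /shape_field; congr (_ + _).
have -> : q = C (\row_i q0 i) + Y *m C M.
  apply/rowP => i; rewrite qE /quadratic_poly map_mx0 quadratic0 !mxE.
  by congr (_ + _); apply: eq_bigr => j _; rewrite !mxE.
rewrite map_mxB map_scalar_mx mulmxBr mul_mx_scalar addrA [in RHS]crossDr.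
by rewrite -scaleNr crossZr crossvv scaler0 addr0.
Qed.

Lemma peval_const x z : peval (mpolyC 3 z : poly3 R) x = z.
Proof. exact: mevalC. Qed.

Lemma vpeval_centered x : vpeval Y x = x - c.
Proof. by apply/rowP => i; rewrite !mxE /peval mevalB mevalXU mevalC. Qed.

Lemma map_peval_const m n (X : 'M[R]_(m, n)) (x : vec R) :
  map_mx (meval (fun i => x 0 i)) (C X) = X.
Proof. by apply/matrixP => i j; rewrite !mxE mevalC. Qed.

Lemma vpeval_shape b q H M x :
  vpeval (shape_vpoly b H q M) x = shape_field b H q M (x - c).
Proof.
rewrite -vpeval_centered /vpeval /peval /shape_vpoly.
rewrite (map_shape_field (meval (fun i => x 0 i))) !map_peval_const //.
Qed.

Lemma vpeval_curl_shape b q H M x : H^T = H ->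
  vpeval (curl (shape_vpoly b H q M)) x = curl_field q M (x - c).
Proof.
move=> sH; rewrite curl_shape_field // -vpeval_centered /vpeval /peval.
rewrite (map_curl_field (meval (fun i => x 0 i))) !map_peval_const //.
Qed.

Lemma peval_affine (p : poly3 R) u v s : deg_le 1 p ->
  peval p (u + s *: (v - u)) = peval p u + s * (peval p v - peval p u).
Proof.
move=> dp; have [p0 [b [_ [_ -> ->]]]] := deg1_affine_rep 0 dp.
by rewrite !peval_affine_poly !subr0 !(dotDl, dotZl, dotNl); ring.
Qed.

End Shape.

Lemma curl_field_affine (R : realType) (q : vec R) (M : 'M[R]_3) u e1 e2 s1 s2 :
  curl_field q M (u + s1 *: e1 + s2 *: e2) = curl_field q M u
    + s1 *: (e1 *m ((\tr M)%:M - M *+ 3)) + s2 *: (e2 *m ((\tr M)%:M - M *+ 3)).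
Proof.
rewrite /curl_field !mulmxDl -!scalemxAl; move: (u *m _) (e1 *m _) (e2 *m _) => w w1 w2.
by rewrite addrAC; congr (_ + _); rewrite addrAC.
Qed.

(** * The degrees of freedom in coordinates *)

Section Dofs.
Variables (R : realType) (a : 'I_4 -> vec R).
Local Notation c := (barycenter a).
Implicit Types (b q : vec R) (H M : 'M[R]_3).

(** The product of two affine functions on an edge is integrated exactly: the
    means contribute their product and the slopes a twelfth of their product. *)
Lemma edge_dof_shape b q H M (e : edge) kappa p : deg_le 1 p ->
  edge_dof a e (kappa *: (tgt a e - src a e)) p (shape_vpoly a b H q M) =
  enorm (tgt a e - src a e) * kappa *
  ((peval p (src a e) + peval p (tgt a e)) / 2
     * edge_circulation b H q M (src a e - c) (tgt a e - c)
   + (peval p (tgt a e) - peval p (src a e)) / 12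
     * edge_slope b H q M (src a e - c) (tgt a e - c)).
Proof.
move=> dp; rewrite /edge_dof /edge_integral /segment_integral -mulrA; congr (_ * _).
set u := src a e; set v := tgt a e.
set m := edge_circulation _ _ _ _ _ _; set d := edge_slope _ _ _ _ _ _.
set x := peval p u; set z := peval p v - x.
transitivity (\int[@lebesgue_measure R]_(s in `[0, 1])
  (kappa * (m - d / 2) * x + kappa * (d * x + (m - d / 2) * z) * s
   + kappa * d * z * s ^+ 2)).
  apply: eq_Rintegral => s _; rewrite vpeval_shape peval_affine //.
  rewrite dotZr (_ : u + _ - c = (u - c) + s *: ((v - c) - (u - c))); last first.
    by rewrite opprB addrA subrK addrAC.
  rewrite (_ : v - u = (v - c) - (u - c)); last by rewrite opprB addrA subrK.
  by rewrite shape_field_along_edge -/m -/d -/x -/z; field.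
rewrite /Rintegral integral_quad //= (_ : peval p v = z + x); last by rewrite subrK.
by field.
Qed.

(** The curl is affine, so its mean over a face is its value at the centroid. *)
Lemma face_dof_shape b q H M F n : H^T = H ->
  face_dof a F n (shape_vpoly a b H q M) = (enorm (face_normal a F) / 2) *:
    cross (curl_field q M (- 3^-1 *: (a F - c))) n.
Proof.
move=> sH; apply/rowP => j; rewrite /face_dof /face_integral [LHS]mxE.
rewrite /triangle_integral -/(face_normal a F).
set u := fvertex a F 0; set e1 := _ - u; set e2 := _ - u.
pose w (x : vec R) := x *m ((\tr M)%:M - M *+ 3).
pose A (x : vec R) : R := cross x n 0 j.
have AD x1 x2 : A (x1 + x2) = A x1 + A x2.
  by rewrite /A crossDl mxE.
have AZ s x : A (s *: x) = s * A x by rewrite /A crossZl mxE.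
transitivity (enorm (face_normal a F) *
  \int[(@lebesgue_measure R \x @lebesgue_measure R)%E]_(s in @unit_triangle R)
   (A (curl_field q M (u - c)) + A (w e1) * s.1 + A (w e2) * s.2)).
  congr (_ * _); apply: eq_Rintegral => s _; rewrite vpeval_curl_shape //.
  rewrite (_ : _ - c = (u - c) + s.1 *: e1 + s.2 *: e2); last first.
    by rewrite addrAC (addrAC u).
  by rewrite curl_field_affine -/(A _) !AD !AZ; ring.
rewrite Rintegral_affine_triangle mulrA [RHS]mxE -/(A _); congr (_ * _).
rewrite -face_centroid // sum3E.
rewrite (_ : 3^-1 *: _ = (u - c) + 3^-1 *: e1 + 3^-1 *: e2).
  by rewrite curl_field_affine !AD !AZ; ring.
by apply/rowP => i; rewrite /e1 /e2 /u !mxE; field.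
Qed.

End Dofs.

(** The moments of an affine function against a basis of polynomials of degree
    at most [k] amount to its mean [m'] and, for [k = 1], its slope [beta'].
    For [k = 1] they are the moments against the affine functions equal to one at
    an end and to zero at the other, up to an invertible matrix [G]: its
    inverse [W] exists since these functions lie in the span of the basis. *)
Lemma edge_moments (R : realType) (k : nat) (u v : vec R)
    (p : 'I_k.+1 -> poly3 R) (kappa : R) (c : 'I_k.+1 -> R) :
  k = 0%N \/ k = 1%N -> dot (v - u) (v - u) != 0 -> kappa != 0 ->
  poly_basis_on (segment u v) k p ->
  exists m beta, forall m' beta',
    (forall i, kappa * ((peval (p i) u + peval (p i) v) / 2 * m'
                 + (peval (p i) v - peval (p i) u) / 12 * beta') = c i) <->
    m' = m /\ (k = 1%N -> beta' = beta).
Proof.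
move=> k01 uv kappa0 [dp span].
have segu : segment u v u by exists 0; rewrite lexx ler01 scale0r addr0.
have segv : segment u v v by exists 1; rewrite lexx ler01 scale1r addrC subrK.
have span_ends l : deg_le k l -> exists w : 'rV_k.+1,
    peval l u = \sum_i w 0 i * peval (p i) u /\
    peval l v = \sum_i w 0 i * peval (p i) v.
  by move=> /span[w [wP _]]; exists w; split; apply: wP.
case: k01 => kE; subst k.
  have [w [w1 _]] := span_ends _ (deg_le_const 1 0).
  move: w1; rewrite peval_const big_ord1 => w1.
  have p0 : peval (p 0) u != 0.
    by apply/eqP => p0; move/eqP: w1; rewrite p0 mulr0 oner_eq0.
  have pE : peval (p 0) v = peval (p 0) u.
    by rewrite (msize1_polyC (dp 0)) !peval_const.
  exists (c 0 / (kappa * peval (p 0) u)), 0 => m' beta'; split.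
    by move=> /(_ 0) <-; split=> //; rewrite pE; field; rewrite kappa0 p0.
  move=> [-> _] i; rewrite ord1 pE; field; first by rewrite kappa0 p0.
have [w0 [w0u w0v]] := span_ends _ (deg_le_const 1 1).
pose l := quadratic_poly u 0 ((dot (v - u) (v - u))^-1 *: (v - u)) 0.
have [w1 [w1u w1v]] := span_ends l (deg_le_affine_poly _ _ _).
rewrite !peval_const in w0u w0v.
have lu : peval l u = 0 by rewrite peval_affine_poly subrr dot0l addr0.
have lv : peval l v = 1 by rewrite peval_affine_poly dotZr mulVf // add0r.
rewrite lu in w1u; rewrite lv in w1v.
pose G : 'M[R]_2 := \matrix_(i, j) if j == 0 then peval (p i) u else peval (p i) v.
pose W : 'M[R]_2 := \matrix_(i, j) if i == 0 then w0 0 j - w1 0 j else w1 0 j.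
have sum2 (F : 'I_2 -> R) : \sum_i F i = F 0 + F 1.
  by rewrite !big_ord_recl big_ord0 addr0; congr (_ + F _); apply: val_inj.
rewrite !sum2 in w0u w0v w1u w1v.
have WG : W *m G = 1%:M.
  apply/matrixP => i j; rewrite !mxE sum2 !mxE.
  case: i => -[|[|//]] ?; case: j => -[|[|//]] ? /=.
  - by rewrite !mulrBl; move: w0u w1u; lra.
  - by rewrite !mulrBl; move: w0v w1v; lra.
  - by move: w1u; lra.
  - by move: w1v; lra.
have GW := mulmx1C WG.
pose S : 'cV[R]_2 := W *m \col_i (c i / kappa).
(* The moments against the two functions that are one at an end and zero at the
   other. *)
pose x m' beta' : 'cV[R]_2 :=
  \col_j if j == 0 then m' / 2 - beta' / 12 else m' / 2 + beta' / 12.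
exists (S 0 0 + S 1 0), (6 * (S 1 0 - S 0 0)) => m' beta'.
have rowE i : kappa * ((peval (p i) u + peval (p i) v) / 2 * m'
    + (peval (p i) v - peval (p i) u) / 12 * beta') =
    kappa * (G *m x m' beta') i 0.
  by rewrite !mxE sum2 !mxE /=; field.
split=> [cE|[mE betaE]].
  suff -> : S = x m' beta' by rewrite !mxE /=; split=> [|_]; field.
  rewrite -[RHS]mul1mx -WG -mulmxA; congr (_ *m _); apply/colP => i.
  by rewrite mxE -cE rowE mulrC mulKf.
have SE : S = x m' beta'.
  apply/colP => i; rewrite [RHS]mxE mE (betaE erefl).
  have [->|->] : i = 0 \/ i = 1.
    by case: i => -[|[|//]] ?; [left|right]; apply: val_inj.
  by rewrite /=; field.
  by rewrite /=; field.
move=> i; rewrite rowE -SE mulmxA GW mul1mx mxE mulrC divfK //.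
Qed.

(** * Unisolvence *)

(** Prescribing the degrees of freedom of a shape function means prescribing the
    right-hand side of the linear system for its normalized coordinates. For
    [k = 0] the vanishing of [H] is encoded by the vanishing of the quadratic
    form on the six edges. *)
Lemma dofs_solves (R : realType) (a : 'I_4 -> vec R) (k : nat)
  (t : edge -> vec R) (n : 'I_4 -> vec R) (q : edge -> 'I_k.+1 -> poly3 R)
  (Knd : nondegenerate_tet a) (k01 : k = 0%N \/ k = 1%N)
  (tP : forall e, unit_tangent a e (t e))
  (qP : forall e, poly_basis_on (segment (src a e) (tgt a e)) k (q e))
  (c : edge -> 'I_k.+1 -> R) (g : 'I_4 -> vec R) :
  exists m beta, forall v : vpoly R,
    [/\ shape_space a k v,
        forall e i, edge_dof a e (t e) (q e i) v = c e i &
        forall F, face_dof a F (n F) v = g F] <->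
    exists b H q M, solves a n k m beta
        (fun F => (enorm (face_normal a F) / 2)^-1 *: g F) (b, H, q, M) /\
      v = shape_vpoly a b H q M.
Proof.
have norm_neq0 F : enorm (face_normal a F) / 2 != 0.
  by rewrite mulf_neq0 ?invr_eq0 ?pnatr_eq0 // enorm_eq0 face_normal_neq0.
have edgeP e : exists kappa m beta, t e = kappa *: (tgt a e - src a e) /\
    forall m' beta', (forall i, enorm (tgt a e - src a e) * kappa *
        ((peval (q e i) (src a e) + peval (q e i) (tgt a e)) / 2 * m'
         + (peval (q e i) (tgt a e) - peval (q e i) (src a e)) / 12 * beta')
        = c e i) <-> m' = m /\ (k = 1%N -> beta' = beta).
  have [t1 [kappa tE]] := tP e.
  have t0 : enorm (t e) != 0 by rewrite t1 oner_eq0.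
  move: t0; rewrite enorm_eq0 tE scaler_eq0 negb_or => /andP[kappa0 d0].
  have dd : dot (tgt a e - src a e) (tgt a e - src a e) != 0.
    by move: d0; rewrite -enorm_eq0; apply: contra => /eqP dd; rewrite /enorm dd sqrtr0.
  have kd : enorm (tgt a e - src a e) * kappa != 0 by rewrite mulf_neq0 // enorm_eq0.
  have [m [beta mP]] := edge_moments (c e) k01 dd kd (qP e).
  by exists kappa, m, beta.
have [kappa /choice[m /choice[beta mP]]] := choice edgeP.
exists m, (fun e => if k == 0%N then 0 else beta e) => v.
have deg_q e i : deg_le 1 (q e i).
  have [dq _] := qP e; apply: leq_trans (dq i) _.
  by case: k01 => ->.
pose y0 e := src a e - barycenter a; pose y1 e := tgt a e - barycenter a.
have edgesE b H r M :
    (forall e i, edge_dof a e (t e) (q e i) (shape_vpoly a b H r M) = c e i) <->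
    forall e, edge_circulation b H r M (y0 e) (y1 e) = m e
      /\ (k = 1%N -> edge_slope b H r M (y0 e) (y1 e) = beta e).
  split=> [cE e|mE e i]; have [tE me] := mP e.
    by apply/me => i; rewrite -cE tE edge_dof_shape.
  by rewrite tE edge_dof_shape //; exact: ((me _ _).2 (mE e)).
split=> [[/(shape_spaceP _ _ k01)[b [H [r [M [sH trM kH ->]]]]] /edgesE cE fE]|].
  exists b, H, r, M; split=> //; split=> // [e|e|F].
  - by have [] := cE e.
  - rewrite /edge_variation; case: eqP => [/kH ->|k0].
      by rewrite mulmx0 dot0l.
    by have [_ ->] := cE e => //; case: k01.
  - by rewrite -fE face_dof_shape // scalerA mulVf // scale1r.
move=> [b [H [r [M [[sH trM cE sE fE] ->]]]]]; split.
- apply/shape_spaceP => //; exists b, H, r, M; split=> // k0.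
  apply: (symmetric_form_eq0 Knd sH); apply: for_all_pairs => [i|i j|e].
  + by rewrite subrr dotC dot0l.
  + by rewrite -(opprB (a j)) mulNmx dotNl dotNr opprK.
  + have := sE e; rewrite /edge_variation k0 /=.
    by rewrite opprB addrA subrK.
- apply/edgesE => e; split; first exact: cE.
  by move=> k1; have := sE e; rewrite /edge_variation k1.
- by move=> F; rewrite face_dof_shape // fE scalerA mulfV // scale1r.
Qed.

Theorem lemma2p1 (R : realType) (a : 'I_4 -> vec R) (k : nat)
  (t : edge -> vec R) (n : 'I_4 -> vec R) (q : edge -> 'I_k.+1 -> poly3 R)
  (Knd : nondegenerate_tet a) (k01 : k = 0%N \/ k = 1%N)
  (tP : forall e, unit_tangent a e (t e))
  (nP : forall F, outward_unit_normal a F (n F))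
  (qP : forall e, poly_basis_on (segment (src a e) (tgt a e)) k (q e))
  (c : edge -> 'I_k.+1 -> R) (g : 'I_4 -> vec R)
  (gP : forall F, dot (g F) (n F) = 0) :
  exists! v : vpoly R,
    [/\ shape_space a k v,
        forall e i, edge_dof a e (t e) (q e i) v = c e i &
        forall F, face_dof a F (n F) v = g F].
Proof.
have [m [beta dofsP]] := dofs_solves n Knd k01 tP qP c g.
have [|[[[b H] r] M] [sol uniq]] := solves_unique k Knd nP m beta
  (g := fun F => (enorm (face_normal a F) / 2)^-1 *: g F).
  by move=> F; rewrite dotZl gP mulr0.
exists (shape_vpoly a b H r M); split; first by apply/dofsP; exists b, H, r, M.
by move=> v /dofsP[b' [H' [r' [M' [/uniq[-> -> -> ->] ->]]]]].
Qed.
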